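(* Let $p,q\in\mathbb{N}$, $\alpha,\beta>-1$, $\lambda\ge0$ with $\alpha+\lambda\ge0$, $A_i,B_j>0$ and $a_i,b_j\ge0$ ($1\le i\le p$, $1\le j\le q$). Let $V_{p,q}^{\alpha,\beta}$ be the generalized Volterra function with upper parameters $(a_i,A_i)_{i\le p}$ and lower parameters $(b_j,B_j)_{j\le q}$, and for $\gamma>-1$ let $V_{p+1,q}^{\gamma,\beta}$ be the one with upper parameters $(a_1,A_1),\dots,(a_p,A_p),(\alpha+\lambda,1)$ and lower parameters $(b_j,B_j)_{j\le q}$. Then the function $$V_{p+1,q}^{\alpha+\lambda,\beta}\Big(\frac1x\Big)=x^{-\lambda}\,V_{p+1,q}^{\alpha,\beta}\Big(\frac1x\Big)$$ has the integral representation $$V_{p+1,q}^{\alpha+\lambda,\beta}\Big(\frac1x\Big)=\int_0^\infty e^{-xt}\,t^{\lambda-1}\,V_{p,q}^{\alpha,\beta}(t)\,dt,\qquad x>0.$$ Moreover, the function $x\mapsto V_{p+1,q}^{\alpha+\lambda,\beta}(1/x)$ is completely monotonic on $(0,\infty)$.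
   Context: For $\gamma,\beta>-1$, the generalized Volterra function with upper parameters $(a_i,A_i)_{1\le i\le p}$ and lower parameters $(b_j,B_j)_{1\le j\le q}$ (with $A_i,B_j>0$, $a_i,b_j\ge0$) is $$V_{p,q}^{\gamma,\beta}(x)=\int_0^\infty \frac{\prod_{i=1}^p\Gamma(A_it+a_i)}{\prod_{j=1}^q\Gamma(B_jt+b_j)}\,\frac{x^{t+\gamma}t^\beta}{\Gamma(\beta+1)}\,dt,\qquad x>0.$$ It is understood throughout that the parameters are such that the integrals defining the generalized Volterra functions in the statement converge for all positive arguments. A function $f:(0,\infty)\to(0,\infty)$ is completely monotonic on $(0,\infty)$ if it is infinitely differentiable and $(-1)^nf^{(n)}(x)\ge0$ for all $x>0$ and $n\in\{0,1,2,\dots\}$. *)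

(* Defs.v *)
From HB Require Import structures.
From mathcomp Require Import all_boot all_order all_algebra.
From mathcomp Require Import all_classical all_reals all_analysis.

Set Implicit Arguments.
Unset Strict Implicit.
Unset Printing Implicit Defensive.

Import Order.TTheory GRing.Theory Num.Theory.
Import numFieldNormedType.Exports.

Local Open Scope classical_set_scope.
Local Open Scope ring_scope.

(* Only meaningful for z > 0, where the integral converges; all the arguments
   occurring in [volterra_integrand] on t > 0 are positive when A_i, B_j > 0,
   a_i, b_j >= 0 and beta > -1. *)
Definition Gamma (R : realType) (z : R) : R :=
  \int[@lebesgue_measure R]_(t in `]0, +oo[) (t `^ (z - 1) * expR (- t)).

(* The i-th upper (resp. lower) parameter is the pair (a_i, A_i)
   (resp. (b_j, B_j)), the second component being the coefficient of t. *)
Definition volterra_integrand (R : realType) (p q : nat)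
    (up : p.-tuple (R * R)) (lo : q.-tuple (R * R)) (gamma beta x t : R) : R :=
  (\prod_(i < p) Gamma ((tnth up i).2 * t + (tnth up i).1)) /
  (\prod_(j < q) Gamma ((tnth lo j).2 * t + (tnth lo j).1)) *
  (x `^ (t + gamma) * t `^ beta / Gamma (beta + 1)).

(* The integrand is nonnegative on t > 0, so Lebesgue integrability is the
   convergence of the integral. *)
Definition volterra_cvg (R : realType) (p q : nat)
    (up : p.-tuple (R * R)) (lo : q.-tuple (R * R)) (gamma beta : R) : Prop :=
  forall x : R, 0 < x ->
    (@lebesgue_measure R).-integrable `]0, +oo[
      (fun t => (volterra_integrand up lo gamma beta x t)%:E).

Definition volterra (R : realType) (p q : nat)
    (up : p.-tuple (R * R)) (lo : q.-tuple (R * R)) (gamma beta x : R) : R :=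
  \int[@lebesgue_measure R]_(t in `]0, +oo[)
    volterra_integrand up lo gamma beta x t.

(* f is a total function on R, but since ]0, +oo[ is open the iterated
   derivatives at x > 0 only depend on its restriction to ]0, +oo[. *)
Definition completely_monotonic (R : realType) (f : R -> R) : Prop :=
  [/\ forall x : R, 0 < x -> 0 < f x,
      forall (n : nat) (x : R), 0 < x -> derivable (derive1n n f) x 1
    & forall (n : nat) (x : R), 0 < x -> 0 <= (-1) ^+ n * derive1n n f x].

(* Main.v *)
(* With W the ratio of Gamma products times s^beta / Gamma(beta + 1), the two
   kinds of Volterra integrands are x^(s+gamma) W(s) and
   x^(s+gamma) Gamma(s+alpha+lambda) W(s).  Inserting
   Gamma(z) x^(-z) = int_0^oo e^(-xt) t^(z-1) dt with z = s + alpha + lambda and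
   exchanging the integrals (Tonelli) yields the representation, which exhibits
   x |-> V(1/x) as the Laplace transform of a nonnegative function.
   Differentiating under the integral sign gives complete monotonicity. *)

Require Import Defs.
From HB Require Import structures.
From mathcomp Require Import all_boot all_order all_algebra.
From mathcomp Require Import all_classical all_reals all_analysis.
From mathcomp Require Import measurable_realfun ring lra.

Import Order.TTheory GRing.Theory Num.Theory.
Import numFieldNormedType.Exports.

Local Open Scope classical_set_scope.
Local Open Scope ring_scope.

(** * Powers against the exponential, and strict positivity of integrals *)

Lemma exprn_le_expR {R : realType} (x : R) (n : nat) :
  0 <= x -> x ^+ n <= n`!%:R * expR x.
Proof.
move=> x0; case: n => [|n]; first by rewrite expr0 fact0 mul1r -expR0 ler_expR.
have := expR_ge1Dxn n x0.
have f0 : 0 < n.+1`!%:R :> R by rewrite ltr0n fact_gt0.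
rewrite -(ler_pM2l f0); apply: le_trans.
by rewrite mulrDr mulr1 mulrCA divff ?gt_eqF// mulr1 lerDr ltW.
Qed.

(** A nonnegative function with zero integral vanishes almost everywhere; since [f] vanishes nowhere
    on the half-line, the half-line would be null. Serves both [Gamma] and the Volterra
    functions. *)
Lemma integral_gt0 {R : realType} (f : R -> R) :
  (@lebesgue_measure R).-integrable `]0, +oo[ (EFin \o f) ->
  (forall t, 0 < t -> 0 < f t) ->
  0 < \int[@lebesgue_measure R]_(t in `]0, +oo[) f t.
Proof.
move=> intf f0; rewrite lt_neqAle; apply/andP; split; last first.
  by apply: Rintegral_ge0 => t /=; rewrite in_itv/= andbT => /f0/ltW.
apply/eqP => /esym If0.
have fin : (\int[@lebesgue_measure R]_(t in `]0%R, +oo[) (f t)%:E)%E \is a fin_num.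
  exact: integrable_fin_num.
have : (\int[@lebesgue_measure R]_(t in `]0%R, +oo[) `|(EFin \o f) t| = 0)%E.
  transitivity ((\int[@lebesgue_measure R]_(t in `]0%R, +oo[) f t)%R%:E); last by rewrite If0.
  rewrite /Rintegral fineK//.
  apply: eq_integral => t; rewrite inE/= in_itv/= andbT => t0.
  by rewrite ger0_norm// ltW// f0.
have mf := measurable_int _ intf.
have mD : measurable (`]0%R, +oo[%classic : set (measurableTypeR R)).
  exact: measurable_itv.
move/(ae_eq_integral_abs _ mD mf) => [N [mN N0 sub]].
have : (@lebesgue_measure R `]0%R, +oo[ <= 0)%E.
  rewrite -N0; apply: le_measure; rewrite ?inE//.
  move=> t /=; rewrite in_itv/= andbT => t0; apply: sub => /= h.
  have := h; rewrite in_itv/= andbT => /(_ t0) [] ft.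
  by have := f0 _ t0; rewrite ft ltxx.
by rewrite lebesgue_measure_itv/= ltry.
Qed.

(** * The substitution t -> x t for Lebesgue measure *)

Lemma lebesgue_measure_scale {R : realType} (x : R) (A : set R) : 0 < x ->
  measurable A ->
  pushforward (@lebesgue_measure R) ( *%R x : _ -> measurableTypeR R) A =
  (x^-1%:E * @lebesgue_measure R A)%E.
Proof.
move=> x0 mA.
have mx : measurable_fun setT (fun t : measurableTypeR R => x * t : measurableTypeR R).
  exact: mulrl_measurable.
(* Lebesgue measure is determined by its values on the intervals ]a, b]. The pushforward rescaled by
   x has those values, the preimage of ]a, b] being ]a/x, b/x]. *)
have -> : lebesgue_measure A = pushforward (mscale (NngNum (ltW x0)) (@lebesgue_measure R))
    ( *%R x : _ -> measurableTypeR R) A.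
  apply: lebesgue_measure_unique => //= _ [[a b]] _ <-.
  rewrite /pushforward /mscale/=.
  have -> : ( *%R x) @^-1` `]a, b] = `]x^-1 * a, x^-1 * b]%classic.
    by apply/seteqP; split => t /=; rewrite !in_itv/= ltr_pdivrMl// ler_pdivlMl.
  rewrite !lebesgue_measure_itv/= !lte_fin ltr_pM2l ?invr_gt0//.
  case: ifP => _; last by rewrite mule0.
  by rewrite -!EFinD -EFinM -mulrBr mulrA divff ?gt_eqF// mul1r.
by rewrite /pushforward /mscale/= muleA -EFinM mulVf ?gt_eqF// mul1e.
Qed.

(** The left side is an integral against the pushforward under t -> x t, which is x^-1 times
    Lebesgue measure; the half-line is its own preimage because x > 0. *)
Lemma ge0_integral_scale {R : realType} (x : R) (f : R -> \bar R) : 0 < x ->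
  measurable_fun [set: R] f -> (forall t, (0 <= f t)%E) ->
  (\int[@lebesgue_measure R]_(t in `]0%R, +oo[) f (x * t)%R =
   x^-1%:E * \int[@lebesgue_measure R]_(t in `]0%R, +oo[) f t)%E.
Proof.
move=> x0 mf f0.
have mx : measurable_fun setT (fun t : measurableTypeR R => x * t : measurableTypeR R).
  exact: mulrl_measurable.
rewrite (_ : `]0, +oo[%classic =
  (fun t : measurableTypeR R => x * t : measurableTypeR R) @^-1` `]0, +oo[); last first.
  by apply/seteqP; split => t /=; rewrite !in_itv/= !andbT pmulr_rgt0.
rewrite -(@ge0_integral_pushforward _ _ _ _ _ _ mx (@lebesgue_measure R) `]0, +oo[ f)//; last first.
  exact: measurable_funTS.
have xV0 : 0 <= x^-1 by rewrite invr_ge0 ltW.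
rewrite [X in (_ * integral _ X _)%E](_ : _ = `]0, +oo[%classic); last first.
  by apply/seteqP; split => t /=; rewrite !in_itv/= !andbT pmulr_rgt0.
rewrite -(@ge0_integral_mscale _ _ _ (@lebesgue_measure R) `]0, +oo[ _
  (NngNum xV0) f)//; last first.
  exact: measurable_funTS.
apply: eq_measure_integral => A mA _.
exact: lebesgue_measure_scale.
Qed.

(** * Convergence, positivity and scaling of the Gamma integral *)

Lemma powR_cvgy {R : realType} (z : R) : 0 < z -> t `^ z @[t --> +oo] --> +oo.
Proof.
move=> z0; apply/cvgryPge => A; near=> t.
(* [A] may be negative, so it is replaced by M = max(A, 1) > 0; then t >= M^(1/z) suffices. *)
have M0 : 0 < Num.max A 1 by rewrite lt_max ltr01 orbT.
apply: (@le_trans _ _ (Num.max A 1)); first by rewrite le_max lexx.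
rewrite -[leLHS](powRr1 (ltW M0)) -(mulVf (lt0r_neq0 z0)) powRrM.
apply: ge0_ler_powR.
- exact: ltW.
- exact: powR_ge0.
- by rewrite nnegrE; near: t; apply: nbhs_pinfty_ge; rewrite num_real.
- by near: t; apply: nbhs_pinfty_ge; rewrite num_real.
Unshelve. all: by end_near. Qed.

(* The majorant is K times the derivative of -1 / (1 + t^z), whose integral over
   any [a, +oo[ with a > 0 is at most K. *)
Lemma Gamma_majorant {R : realType} (z : R) : 0 < z -> exists2 K : R, 0 < K &
  forall t, 0 < t ->
    t `^ (z - 1) * expR (- t) <= K * (z * t `^ (z - 1) * (1 + t `^ z)^-1 ^+ 2).
Proof.
move=> z0; pose n := (Num.truncn z).+1.
(* With n an integer above z, t^z <= 1 + t^n (the 1 serves t <= 1, the power t > 1). Hence (1 +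
   t^z)^2 <= (2 + t^n)^2 <= 8 + 2 t^(2n), the last step being (2 - t^n)^2 >= 0. Now 1 <= e^t and
   t^(2n) <= (2n)! e^t bound this by C e^t. *)
pose C : R := 8 + 2 * (2 * n)`!%:R.
have C0 : 0 < C by rewrite /C ltr_pwDl// mulr_ge0.
exists (C / z); first by rewrite divr_gt0.
move=> t t0.
have p0 : 0 < 1 + t `^ z by rewrite ltr_wpDr ?powR_ge0.
have -> : C / z * (z * t `^ (z - 1) * (1 + t `^ z)^-1 ^+ 2) =
    t `^ (z - 1) * (C / (1 + t `^ z) ^+ 2) by field; rewrite !gt_eqF.
rewrite ler_wpM2l ?powR_ge0//.
rewrite ler_pdivlMr ?exprn_gt0// expRN mulrC ler_pdivrMr ?expR_gt0//.
have tn0 : 0 <= t ^+ n by rewrite exprn_ge0// ltW.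
have tz : t `^ z <= 1 + t ^+ n.
  have [t1|t1] := lerP t 1.
    apply: (@le_trans _ _ 1); last by rewrite lerDl.
    by rewrite -(powRr0 t) ger_powR// ?t0// ltW.
  apply: (@le_trans _ _ (t ^+ n)); last by rewrite lerDr.
  rewrite -powR_mulrn ?(ltW t0)// ler_powR ?(ltW t1)//.
  by rewrite ltW// /n truncnS_gt.
have h2 := exprn_le_expR t (2 * n) (ltW t0).
have e1 : 1 <= expR t by rewrite -expR0 ler_expR ltW.
apply: (@le_trans _ _ (8 + 2 * t ^+ (2 * n))).
  rewrite mulnC exprM; apply: (@le_trans _ _ ((2 + t ^+ n) ^+ 2)).
    by rewrite ler_pXn2r ?nnegrE ?addr_ge0 ?powR_ge0//; lra.
  by have := sqr_ge0 (2 - t ^+ n); rewrite !expr2; lra.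
rewrite /C [leRHS]mulrDl; apply: lerD; first by rewrite ler_peMr.
by rewrite -mulrA ler_pM2l.
Qed.

(** The majorant [g] is minus the derivative of [q], and [q] tends to 0 at infinity, so its integral
    over [a, +oo[ is q(a) <= 1. The resulting bound [K] does not depend on a > 0 and survives a ->
    0, where t^(z-1) may be singular. *)
Lemma Gamma_ltey {R : realType} (z : R) : 0 < z ->
  (\int[@lebesgue_measure R]_(t in `]0%R, +oo[) (t `^ (z - 1) * expR (- t))%:E < +oo)%E.
Proof.
move=> z0; have [K K0 hK] := Gamma_majorant _ z0.
pose f t : R := t `^ (z - 1) * expR (- t).
pose q t : R := (1 + t `^ z)^-1.
pose g t : R := z * t `^ (z - 1) * q t ^+ 2.
have p0 t : 0 < 1 + t `^ z by rewrite ltr_wpDr ?powR_ge0.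
have g0 t : 0 <= g t.
  by rewrite mulr_ge0// ?sqr_ge0// mulr_ge0 ?powR_ge0// ltW.
have f0 t : 0 <= f t by rewrite mulr_ge0 ?powR_ge0 ?expR_ge0.
have mf : measurable_fun [set: R] f.
  apply: measurable_funM; first exact: measurable_powR.
  by apply: measurableT_comp; [exact: measurable_expR|exact: oppr_measurable].
have dp (t : R) : 0 < t -> is_derive t 1 (fun s : R => 1 + s `^ z) (0 + z * t `^ (z - 1)).
  by move=> t0; apply: is_deriveD; exact: is_derive1_powR.
have dq (t : R) : 0 < t -> is_derive t 1 q (- g t).
  move=> t0; have d := @is_deriveV R (fun s => 1 + s `^ z) t _ _ (lt0r_neq0 (p0 t)) (dp t t0).
  by apply: (is_derive_eq d); rewrite /g /q add0r scaleNr exprVn -[_ *: _]/(_ * _) mulrC.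
have qy : q t @[t --> +oo] --> 0.
  apply/gtr0_cvgV0; first by near=> t.
  apply/cvgryPge => A; near=> t.
  have : A <= t `^ z by near: t; move/cvgryPge: (powR_cvgy z z0); exact.
  by move=> h; rewrite (le_trans h)// lerDr.
have mg a : 0 < a -> {within `[a, +oo[, continuous g}.
  move=> a0; apply: continuous_in_subspaceT => t.
  rewrite inE/= in_itv/= andbT => at_; have t0 := lt_le_trans a0 at_.
  have [dq1 _] := dq t t0; have [dw _] := is_derive1_powR (z - 1) t0.
  have cq := differentiable_continuous ((derivable1_diffP _ _).1 dq1).
  have cw := differentiable_continuous ((derivable1_diffP _ _).1 dw).
  exact: cvgM (cvgM (cvg_cst z) cw) (cvgM cq cq).
have Ig a : 0 < a -> (\int[@lebesgue_measure R]_(t in `[a, +oo[) (g t)%:E <= 1)%E.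
  move=> a0; rewrite (@ge0_continuous_FTC2y _ _ (fun t => - q t) _ 0)//.
  - rewrite -EFinB sub0r opprK lee_fin invf_le1//.
    by rewrite lerDl powR_ge0.
  - exact: mg.
  - by rewrite -oppr0; exact: cvgN.
  - by move=> t at_; have [d _] := dq t (lt_trans a0 at_); exact: derivableN.
  - apply: cvgN; apply: cvg_at_right_filter.
    have [d _] := dq a a0.
    exact/differentiable_continuous/derivable1_diffP.
  - move=> t; rewrite in_itv/= andbT => at_; rewrite derive1E.
    have [d e] := dq t (lt_trans a0 at_).
    by rewrite deriveN// e opprK.
have If a : 0 < a -> (\int[@lebesgue_measure R]_(t in `[a, +oo[) (f t)%:E <= K%:E)%E.
  move=> a0; have mga : measurable_fun `[a, +oo[ g.
    apply: subspace_continuous_measurable_fun => //; exact: mg.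
  apply: (@le_trans _ _ (\int[@lebesgue_measure R]_(t in `[a, +oo[) (K%:E * (g t)%:E))%E).
    apply: ge0_le_integral => //.
    - by move=> t _; rewrite lee_fin.
    - by apply/measurable_EFinP; exact: measurable_funTS.
    - by apply: emeasurable_funM => //; apply/measurable_EFinP.
    - move=> t /=; rewrite in_itv/= andbT => at_.
      by rewrite -EFinM lee_fin hK// (lt_le_trans a0).
  rewrite ge0_integralZl//; last 3 first.
  - exact/measurable_EFinP.
  - by move=> t _; rewrite lee_fin.
  - by rewrite lee_fin ltW.
  by rewrite -[leRHS]mule1 lee_pmul2l// Ig.
(* These half-lines increase to []0, +oo[], so monotone convergence passes the uniform bound to the
   limit. *)
pose D n := `[(n.+1%:R : R)^-1, +oo[%classic.
have DU : `]0, +oo[%classic = \bigcup_n D n.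
  apply/seteqP; split => t /=.
    rewrite in_itv/= andbT => t0.
    exists (Num.truncn t^-1) => //=; rewrite /D/= in_itv/= andbT.
    by rewrite -[leRHS]invrK lef_pV2 ?posrE ?invr_gt0// ltW// truncnS_gt.
  move=> [n _]; rewrite /D/= !in_itv/= !andbT; apply: lt_le_trans.
  by rewrite invr_gt0.
have H : (\int[@lebesgue_measure R]_(t in D n) (f t)%:E @[n --> \oo] -->
    \int[@lebesgue_measure R]_(t in `]0%R, +oo[) (f t)%:E)%E.
  rewrite DU; apply: ge0_nondecreasing_set_cvg_integral => //.
  - apply/nondecreasing_seqP => n; rewrite subsetEset /D => t /=.
    rewrite !in_itv/= !andbT; apply: le_trans.
    by rewrite lef_pV2 ?posrE// ler_nat.
  - by move=> n; exact: measurable_itv.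
  - by move=> n; apply/measurable_EFinP; exact: measurable_funTS.
  - by move=> n t _; rewrite lee_fin.
apply: (@le_lt_trans _ _ K%:E); last exact: ltry.
rewrite -(cvg_lim _ H)//; apply: lime_le; first by apply/cvg_ex; eexists; exact: H.
by near=> n; apply: If; rewrite invr_gt0.
Unshelve. all: by end_near. Qed.

Lemma Gamma_gt0 {R : realType} (z : R) : 0 < z -> 0 < Gamma z.
Proof.
move=> z0; apply: integral_gt0; last first.
  by move=> t t0; rewrite mulr_gt0 ?powR_gt0 ?expR_gt0.
apply/integrableP; split.
  apply/measurable_EFinP/measurable_funTS; apply: measurable_funM => //.
  by apply: measurableT_comp; [exact: measurable_expR|exact: oppr_measurable].
under eq_integral do rewrite /= ger0_norm ?mulr_ge0 ?powR_ge0 ?expR_ge0//.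
exact: Gamma_ltey.
Qed.

(** [Gamma] is the real part [fine] of an extended integral, which would send +oo to 0; finiteness
    makes the two agree. *)
Lemma EFin_Gamma {R : realType} (z : R) : 0 < z ->
  (\int[@lebesgue_measure R]_(t in `]0%R, +oo[) (t `^ (z - 1) * expR (- t))%:E =
   (Gamma z)%:E)%E.
Proof.
move=> z0; rewrite /Gamma /Rintegral fineK// ge0_fin_numE; first exact: Gamma_ltey.
by apply: integral_ge0 => t _; rewrite lee_fin mulr_ge0 ?powR_ge0 ?expR_ge0.
Qed.

Lemma integral_Gamma_scale {R : realType} (x z : R) : 0 < x -> 0 < z ->
  (\int[@lebesgue_measure R]_(t in `]0%R, +oo[) (expR (- (x * t)) * t `^ (z - 1))%:E =
   (x^-1 `^ z * Gamma z)%:E)%E.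
Proof.
move=> x0 z0; pose f (t : R) := (t `^ (z - 1) * expR (- t))%:E.
have f0 t : (0 <= f t)%E by rewrite lee_fin mulr_ge0 ?powR_ge0 ?expR_ge0.
have mf : measurable_fun [set: R] f.
  apply/measurable_EFinP; apply: measurable_funM => //.
  by apply: measurableT_comp; [exact: measurable_expR|exact: oppr_measurable].
(* Writing t^(z-1) = x^(1-z) (x t)^(z-1) gives a rescaled Gamma integrand. The substitution
   contributes a further x^-1, for a total factor x^(-z). *)
transitivity (\int[@lebesgue_measure R]_(t in `]0%R, +oo[)
    ((x `^ (1 - z))%:E * f (x * t)%R))%E.
  apply: eq_integral => t; rewrite inE/= in_itv/= andbT => t0.
  rewrite /f -EFinM powRM ?(ltW x0) ?(ltW t0)// !mulrA -powRD.
    by rewrite addrA subrK subrr powRr0 mul1r mulrC.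
  by rewrite (gt_eqF x0) implybT.
rewrite ge0_integralZl//; last 2 first.
- apply: measurable_funTS; apply: measurableT_comp mf _.
  exact: mulrl_measurable.
- by rewrite lee_fin powR_ge0.
rewrite (ge0_integral_scale _ _ x0 mf f0) EFin_Gamma// muleA -!EFinM.
congr (_ * _)%:E; rewrite -[X in _ / X]powRr1 ?(ltW x0)// -powRB; last first.
  by rewrite (gt_eqF x0) implybT.
by rewrite -powR_inv1 ?(ltW x0)// -powRrM mulN1r addrAC subrr sub0r.
Qed.

(** * Tonelli on a rectangle and the exchange behind the Laplace representation *)

Lemma ge0_fubini_tonelli {d1 d2 : measure_display} {T1 : measurableType d1}
    {T2 : measurableType d2} {R : realType}
    (m1 : {sigma_finite_measure set T1 -> \bar R})
    (m2 : {sigma_finite_measure set T2 -> \bar R})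
    (D1 : set T1) (D2 : set T2) (f : T1 * T2 -> \bar R) :
  measurable D1 -> measurable D2 -> measurable_fun (D1 `*` D2) f ->
  (forall x y, D1 x -> D2 y -> (0 <= f (x, y))%E) ->
  measurable_fun D1 (fun x => \int[m2]_(y in D2) f (x, y))%E /\
  (\int[m1]_(x in D1) \int[m2]_(y in D2) f (x, y) =
   \int[m2]_(y in D2) \int[m1]_(x in D1) f (x, y))%E.
Proof.
(* Extension by zero off the rectangle reduces to Tonelli on the whole product; [E1] and [E2] say
   that the inner integrals of [F] are the zero extensions of those of [f]. *)
move=> mD1 mD2 mf f0; pose F := f \_ (D1 `*` D2).
have mF : measurable_fun [set: T1 * T2] F.
  exact/(measurable_restrictT _ (measurableX mD1 mD2)).
have F0 z : (0 <= F z)%E.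
  by apply: erestrict_ge0 => -[x y] [/= ? ?]; exact: f0.
have E1 : (fun x => \int[m2]_y F (x, y))%E =
    (fun x => \int[m2]_(y in D2) f (x, y))%E \_ D1.
  apply/funext => x; rewrite patchE; case: ifPn => xD1.
    rewrite [RHS]integral_mkcond; apply: eq_integral => y _; rewrite /F !patchE.
    by rewrite in_setX xD1.
  by rewrite integral0_eq// => y _; rewrite /F patchE in_setX (negbTE xD1).
have E2 : (fun y => \int[m1]_x F (x, y))%E =
    (fun y => \int[m1]_(x in D1) f (x, y))%E \_ D2.
  apply/funext => y; rewrite patchE; case: ifPn => yD2.
    rewrite [RHS]integral_mkcond; apply: eq_integral => x _; rewrite /F !patchE.
    by rewrite in_setX yD2 andbT.
  by rewrite integral0_eq// => x _; rewrite /F patchE in_setX (negbTE yD2) andbF.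
split.
  apply/(measurable_restrictT _ mD1); rewrite -E1.
  exact: measurable_fun_fubini_tonelli_F.
rewrite [LHS]integral_mkcond -E1 [RHS]integral_mkcond -E2.
exact: fubini_tonelli.
Qed.

(** The kernel [k] integrates over s to [L] and over t to the integrand with the Gamma factor.
    Integrability is assumed only on the Gamma side and for each [V t]; Tonelli transfers it to
    [L]. *)
Lemma laplace_mellin {R : realType} (W : R -> R) (alpha lambda x : R) :
  0 <= alpha + lambda -> 0 < x ->
  measurable_fun (`]0, +oo[ : set R) W -> (forall s, 0 < s -> 0 <= W s) ->
  (forall t, 0 < t -> (@lebesgue_measure R).-integrable `]0, +oo[
    (fun s => (t `^ (s + alpha) * W s)%:E)) ->
  (@lebesgue_measure R).-integrable `]0, +oo[
    (fun s => (x^-1 `^ (s + (alpha + lambda)) * Gamma (s + (alpha + lambda)) * W s)%:E) ->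
  let V t := \int[@lebesgue_measure R]_(s in `]0, +oo[) (t `^ (s + alpha) * W s) in
  let L t := expR (- (x * t)) * t `^ (lambda - 1) * V t in
  (@lebesgue_measure R).-integrable `]0, +oo[ (fun t => (L t)%:E) /\
  \int[@lebesgue_measure R]_(s in `]0, +oo[)
    (x^-1 `^ (s + (alpha + lambda)) * Gamma (s + (alpha + lambda)) * W s) =
  \int[@lebesgue_measure R]_(t in `]0, +oo[) L t.
Proof.
move=> al0 x0 mW W0 iV iG V L.
pose P : set R := (`]0, +oo[)%classic.
have PE t : P t = (0 < t) :> Prop by rewrite /P/= in_itv/= andbT.
pose k (z : R * R) : R :=
  expR (- (x * z.1)) * z.1 `^ (lambda - 1) * (z.1 `^ (z.2 + alpha) * W z.2).
have mP : measurable (P : set (measurableTypeR R)) by exact: measurable_itv.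
have mPP : measurable ((P `*` P) : set (measurableTypeR R * measurableTypeR R)).
  exact: measurableX.
have mk : measurable_fun ((P `*` P) : set (measurableTypeR R * measurableTypeR R))
    (EFin \o k).
  apply/measurable_EFinP; apply: measurable_funM.
    apply: measurable_funTS; apply: measurable_funM.
      apply: measurableT_comp; first exact: measurable_expR.
      apply: measurableT_comp; first exact: oppr_measurable.
      by apply: measurable_funM.
    exact: (measurableT_comp (measurable_powR _) measurable_fst).
  apply: measurable_funM; last first.
    have sub : (snd : measurableTypeR R * measurableTypeR R -> measurableTypeR R)
        @` (P `*` P) `<=` P by move=> _ [[t s] [_ ?]] <-.
    refine (measurable_comp mP sub mW _); exact: measurable_funTS.
  (* Joint measurability of t^(s+alpha) is seen on exp((s+alpha) ln t), which equals [powR] for t >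
     0 but not at t = 0. *)
  have me : measurable_fun [set: measurableTypeR R * measurableTypeR R]
      (fun z : measurableTypeR R * measurableTypeR R => expR ((z.2 + alpha) * ln z.1)).
    apply: measurableT_comp; first exact: measurable_expR.
    apply: measurable_funM; first exact: measurable_funD.
    exact: (measurableT_comp (@measurable_ln R) measurable_fst).
  have me' : measurable_fun (P `*` P) _ := measurable_funTS me.
  apply: eq_measurable_fun me' => -[t s].
  by rewrite inE => -[/=]; rewrite PE => t0 _; rewrite /powR gt_eqF.
have k0 t s : P t -> P s -> (0 <= (EFin \o k) (t, s))%E.
  rewrite !PE => t0 s0; rewrite lee_fin /k/= !mulr_ge0 ?expR_ge0 ?powR_ge0//.
  exact: W0.
have [mI TI] := @ge0_fubini_tonelli _ _ _ _ R (@lebesgue_measure R)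
  (@lebesgue_measure R) P P (EFin \o k) mP mP mk k0.
have EL t : P t -> (\int[@lebesgue_measure R]_(s in P) (EFin \o k) (t, s) = (L t)%:E)%E.
  rewrite PE => t0; rewrite /L EFinM /V /Rintegral fineK; last first.
    by apply: integrable_fin_num => //; exact: iV.
  rewrite -ge0_integralZl//.
  - exact: measurable_int (iV t t0).
  - move=> s /=; rewrite in_itv/= andbT => s0.
    by rewrite lee_fin mulr_ge0 ?powR_ge0// W0.
  - by rewrite lee_fin mulr_ge0 ?powR_ge0 ?expR_ge0.
(* The exponents of t add up to z - 1 with z = s + (alpha + lambda), and z > 0 since s > 0 and alpha
   + lambda >= 0. *)
have EG s : P s -> (\int[@lebesgue_measure R]_(t in P) (EFin \o k) (t, s) =
   (x^-1 `^ (s + (alpha + lambda)) * Gamma (s + (alpha + lambda)) * W s)%:E)%E.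
  rewrite PE => s0; have z0 : 0 < s + (alpha + lambda) by rewrite ltr_pwDl.
  rewrite [RHS]EFinM -integral_Gamma_scale// muleC -ge0_integralZl//; last 3 first.
  - apply/measurable_EFinP; apply: measurable_funTS; apply: measurable_funM.
      apply: measurableT_comp; first exact: measurable_expR.
      apply: measurableT_comp; first exact: oppr_measurable.
      exact: mulrl_measurable.
    exact: measurable_powR.
  - by move=> t _; rewrite lee_fin mulr_ge0 ?powR_ge0 ?expR_ge0.
  - by rewrite lee_fin W0.
  apply: eq_integral => t; rewrite inE PE => t0.
  rewrite /k/= -EFinM; congr EFin.
  rewrite mulrA mulrC -!mulrA; congr (_ * (_ * _)).
  by rewrite -powRD ?(gt_eqF t0) ?implybT//; congr (_ `^ _); ring.
have L0 t : P t -> 0 <= L t.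
  rewrite PE => t0; rewrite /L mulr_ge0 ?mulr_ge0 ?expR_ge0 ?powR_ge0//.
  apply: Rintegral_ge0 => s; rewrite -/(P s) PE => s0.
  by rewrite mulr_ge0 ?powR_ge0// W0.
have IE : (\int[@lebesgue_measure R]_(t in P) (L t)%:E =
   \int[@lebesgue_measure R]_(s in P)
    (x^-1 `^ (s + (alpha + lambda)) * Gamma (s + (alpha + lambda)) * W s)%:E)%E.
  under eq_integral => t /[!inE] Pt do rewrite -EL//.
  by rewrite TI; apply: eq_integral => s /[!inE] Ps; exact: EG.
split; last by rewrite /Rintegral IE.
(* Measurability of [L] is the measurability half of Tonelli; finiteness of its integral comes from
   [IE]. *)
apply/integrableP; split.
  apply: eq_measurable_fun mI => t /[!inE] Pt; exact: EL.
under eq_integral => t /[!inE] Pt do rewrite gee0_abs ?lee_fin ?L0//.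
by rewrite IE; exact: integrable_lty.
Qed.

(** * Differentiating a Laplace transform under the integral sign *)

Lemma integrable_laplace_exprn {R : realType} (g : R -> R) (n : nat) (x : R) :
  (forall y : R, 0 < y -> (@lebesgue_measure R).-integrable `]0, +oo[
    (fun t => (expR (- (y * t)) * g t)%:E)) ->
  0 < x -> (@lebesgue_measure R).-integrable `]0, +oo[
    (fun t => ((- t) ^+ n * (expR (- (x * t)) * g t))%:E).
Proof.
move=> ig x0; have x20 : 0 < x / 2 by rewrite divr_gt0.
(* Split e^(-xt) into two factors e^(-xt/2). One absorbs the power, as t^n <= C e^(xt/2); the other
   leaves the integrand at y = x/2. *)
pose C : R := n`!%:R / (x / 2) ^+ n.
have mP : measurable (`]0, +oo[%classic : set (measurableTypeR R)) by exact: measurable_itv.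
have iC := integrableZl mP C (ig _ x20).
apply: le_integrable iC => //.
  apply/measurable_EFinP; apply: measurable_funM.
    apply: measurable_funTS; apply: measurable_funX; exact: oppr_measurable.
  by apply/measurable_EFinP; exact: measurable_int (ig x x0).
move=> t /=; rewrite in_itv/= andbT => t0.
have C0 : 0 <= C by rewrite divr_ge0// exprn_ge0// ltW.
rewrite lee_fin [leRHS]normrM (ger0_norm C0) !normrM !(ger0_norm (expR_ge0 _)) mulrA [leRHS]mulrA.
rewrite ler_wpM2r// normrX normrN (ger0_norm (ltW t0)).
have -> : - (x * t) = - (x / 2 * t) - x / 2 * t by field.
rewrite expRD mulrCA [leRHS]mulrC ler_wpM2l ?expR_ge0//.
rewrite expRN ler_pdivrMr ?expR_gt0// /C mulrAC ler_pdivlMr ?exprn_gt0//.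
rewrite -exprMn [t * _]mulrC; apply: exprn_le_expR.
by rewrite mulr_ge0// ltW.
Qed.

Lemma is_derive_laplace {R : realType} (g : R -> R) (n : nat) (x : R) :
  (forall y : R, 0 < y -> (@lebesgue_measure R).-integrable `]0, +oo[
    (fun t => (expR (- (y * t)) * g t)%:E)) ->
  0 < x -> is_derive x 1
    (fun y => \int[@lebesgue_measure R]_(t in `]0, +oo[)
      ((- t) ^+ n * (expR (- (y * t)) * g t)))
    (\int[@lebesgue_measure R]_(t in `]0, +oo[)
      ((- t) ^+ n.+1 * (expR (- (x * t)) * g t))).
Proof.
move=> ig x0; have x20 : 0 < x / 2 by rewrite divr_gt0.
pose f (y t : R) := (- t) ^+ n * (expR (- (y * t)) * g t).
(* For t > 0 the factor e^(-yt) decreases in y, so on the neighbourhood ]x/2, 2x[ of x the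
   y-derivative is dominated by its absolute value at y = x/2. *)
pose G (t : R) := `|(- t) ^+ n.+1 * (expR (- (x / 2 * t)) * g t)|.
have df (y t : R) : is_derive y 1 (f ^~ t) ((- t) ^+ n.+1 * (expR (- (y * t)) * g t)).
  have d1 : is_derive y 1 (fun s : R => - t * s) (- t).
    by have := is_deriveZ (- t) (is_derive_id y 1); rewrite [- t *: 1]mulr1; exact.
  have d2 := is_derive1_comp (is_derive_expR (- t * y)) d1.
  have := is_deriveZ ((- t) ^+ n * g t) d2.
  have -> : ((- t) ^+ n * g t) \*: (expR \o (fun s : R => - t * s)) = f ^~ t.
    by apply/funext => s; rewrite /f/= -[_ *: _]/(_ * _) mulNr [t * s]mulrC; ring.
  by move=> d3; apply: (is_derive_eq d3); rewrite exprS -[_ *: _]/(_ * _) mulNr [t * y]mulrC; ring.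
have iG : (@lebesgue_measure R).-integrable `]0, +oo[ (EFin \o G).
  apply: integrable_norm; exact: integrable_laplace_exprn.
have xI : `]x / 2, x * 2[%classic x.
  by rewrite /= in_itv/=; apply/andP; split; lra.
have fI y : `]x / 2, x * 2[%classic y -> (@lebesgue_measure R).-integrable `]0, +oo[ (EFin \o f y).
  rewrite /= in_itv/= => /andP[y0 _]; apply: integrable_laplace_exprn => //.
  exact: lt_trans y0.
have dfI y t : `]x / 2, x * 2[%classic y -> `]0, +oo[%classic t -> derivable (f ^~ t) y 1.
  by move=> _ _; have [] := df y t.
have G0 t : 0 <= G t by exact: normr_ge0.
have Gub y t : `]x / 2, x * 2[%classic y -> `]0, +oo[%classic t ->
    `|partial1of2 f y t| <= G t.
  rewrite /= !in_itv/= andbT => /andP[y0 _] t0.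
  rewrite partial1of2E; have [_ ->] := df y t.
  rewrite /G !normrM ler_wpM2l// ler_wpM2r// !(ger0_norm (expR_ge0 _)).
  by rewrite ler_expR lerN2 ler_pM2r// ltW.
have mP : measurable (`]0, +oo[%classic : set (measurableTypeR R)) by exact: measurable_itv.
have D1 := derivable_under_integral mP xI fI dfI G0 iG Gub.
have D2 := differentiation_under_integral mP xI fI dfI G0 iG Gub.
apply: DeriveDef; first exact: D1.
rewrite -derive1E D2; apply: eq_Rintegral => t _.
by rewrite partial1of2E; have [_ ->] := df x t.
Qed.

(** Derivatives are local and each y > 0 has a neighbourhood inside the open half-line, so the
    induction needs the integral formula for positive arguments only. *)
Lemma derive1n_laplace {R : realType} (f g : R -> R) :
  (forall y : R, 0 < y -> (@lebesgue_measure R).-integrable `]0, +oo[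
    (fun t => (expR (- (y * t)) * g t)%:E)) ->
  (forall y : R, 0 < y -> f y =
    \int[@lebesgue_measure R]_(t in `]0, +oo[) (expR (- (y * t)) * g t)) ->
  forall (n : nat) (x : R), 0 < x ->
  derivable (derive1n n f) x 1 /\
  derive1n n f x = \int[@lebesgue_measure R]_(t in `]0, +oo[)
    ((- t) ^+ n * (expR (- (x * t)) * g t)).
Proof.
move=> ig fE.
have E n : forall x : R, 0 < x -> derive1n n f x =
    \int[@lebesgue_measure R]_(t in `]0, +oo[) ((- t) ^+ n * (expR (- (x * t)) * g t)).
  elim: n => [|n IH] x x0.
    by rewrite derive1n0 fE//; apply: eq_Rintegral => t _; rewrite expr0 mul1r.
  rewrite derive1nS derive1E.
  have [_ <-] := is_derive_laplace g n x ig x0.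
  apply: near_eq_derive.
  by near=> y; apply: IH; near: y; exact: lt_nbhsr.
move=> n x x0; split; last exact: E.
have [d _] := is_derive_laplace g n x ig x0.
apply: near_eq_derivable d.
by near=> y; rewrite E//; near: y; exact: lt_nbhsr.
Unshelve. all: by end_near. Qed.

(** * The weight shared by both kinds of Volterra integrands *)

Definition volterra_weight {R : realType} {p q : nat} (up : p.-tuple (R * R))
    (lo : q.-tuple (R * R)) (beta s : R) : R :=
  (\prod_(i < p) Gamma ((tnth up i).2 * s + (tnth up i).1)) /
  (\prod_(j < q) Gamma ((tnth lo j).2 * s + (tnth lo j).1)) *
  (s `^ beta / Gamma (beta + 1)).

Lemma volterra_integrandE {R : realType} {p q : nat} (up : p.-tuple (R * R))
    (lo : q.-tuple (R * R)) (gamma beta x s : R) :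
  volterra_integrand up lo gamma beta x s =
  x `^ (s + gamma) * volterra_weight up lo beta s.
Proof. by rewrite /volterra_integrand /volterra_weight; ring. Qed.

(** The appended parameter is the last factor of the product and has coefficient 1, so it
    contributes exactly Gamma(s + a). *)
Lemma volterra_integrand_rcons {R : realType} {p q : nat} (up : p.-tuple (R * R))
    (lo : q.-tuple (R * R)) (a gamma beta x s : R) :
  volterra_integrand (rcons_tuple up (a, 1)) lo gamma beta x s =
  x `^ (s + gamma) * Gamma (s + a) * volterra_weight up lo beta s.
Proof.
rewrite /volterra_integrand /volterra_weight big_ord_recr/=.
have -> : tnth (rcons_tuple up (a, 1)) ord_max = (a, 1).
  by rewrite (tnth_nth 0) /= nth_rcons size_tuple ltnn eqxx.
rewrite /= mul1r.
under eq_bigr => i _ do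
  rewrite (tnth_nth 0) /= nth_rcons size_tuple ltn_ord -tnth_nth.
ring.
Qed.

Lemma prod_Gamma_gt0 {R : realType} {p : nat} (up : p.-tuple (R * R)) (s : R) :
  (forall i, 0 <= (tnth up i).1 /\ 0 < (tnth up i).2) -> 0 < s ->
  0 < \prod_(i < p) Gamma ((tnth up i).2 * s + (tnth up i).1).
Proof.
move=> hup s0; apply: prodr_gt0 => i _; have [a0 A0] := hup i.
by apply: Gamma_gt0; rewrite ltr_wpDr ?mulr_gt0.
Qed.

Lemma volterra_weight_gt0 {R : realType} {p q : nat} (up : p.-tuple (R * R))
    (lo : q.-tuple (R * R)) (beta s : R) :
  (forall i, 0 <= (tnth up i).1 /\ 0 < (tnth up i).2) ->
  (forall j, 0 <= (tnth lo j).1 /\ 0 < (tnth lo j).2) ->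
  -1 < beta -> 0 < s -> 0 < volterra_weight up lo beta s.
Proof.
move=> hup hlo hbeta s0.
rewrite mulr_gt0 ?divr_gt0 ?prod_Gamma_gt0 ?powR_gt0// Gamma_gt0//.
by rewrite -ltrBlDr sub0r.
Qed.

(** * Scaling relation, Laplace representation and complete monotonicity *)

Theorem theorem3 (R : realType) (p q : nat)
    (up : p.-tuple (R * R)) (lo : q.-tuple (R * R)) (alpha beta lambda : R)
    (halpha : -1 < alpha) (hbeta : -1 < beta)
    (hlambda : 0 <= lambda) (halphalambda : 0 <= alpha + lambda)
    (hup : forall i : 'I_p, 0 <= (tnth up i).1 /\ 0 < (tnth up i).2)
    (hlo : forall j : 'I_q, 0 <= (tnth lo j).1 /\ 0 < (tnth lo j).2) :
  let up1 : p.+1.-tuple (R * R) := rcons_tuple up (alpha + lambda, 1) in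
  volterra_cvg up lo alpha beta ->
  volterra_cvg up1 lo alpha beta ->
  volterra_cvg up1 lo (alpha + lambda) beta ->
  [/\ forall x : R, 0 < x ->
        volterra up1 lo (alpha + lambda) beta x^-1 =
        x `^ (- lambda) * volterra up1 lo alpha beta x^-1,
      forall x : R, 0 < x ->
        (@lebesgue_measure R).-integrable `]0, +oo[
          (fun t => (expR (- (x * t)) * t `^ (lambda - 1) *
                     volterra up lo alpha beta t)%:E) /\
        volterra up1 lo (alpha + lambda) beta x^-1 =
        \int[@lebesgue_measure R]_(t in `]0, +oo[)
          (expR (- (x * t)) * t `^ (lambda - 1) * volterra up lo alpha beta t)
    & completely_monotonic
        (fun x : R => volterra up1 lo (alpha + lambda) beta x^-1)].
Proof.
move=> up1 cV cV1 cV2.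
pose W := volterra_weight up lo beta.
pose V t := \int[@lebesgue_measure R]_(s in `]0, +oo[) (t `^ (s + alpha) * W s).
have W0 s : 0 < s -> 0 < W s by exact: volterra_weight_gt0.
(* At x = 1 the power of x disappears from the integrand, so the convergence
   hypothesis already contains the measurability of W. *)
have mW : measurable_fun (`]0, +oo[ : set R) W.
  have /measurable_EFinP := measurable_int _ (cV 1 ltr01).
  by apply: eq_measurable_fun => s _; rewrite volterra_integrandE powR1 mul1r.
have VE t : volterra up lo alpha beta t = V t.
  by apply: eq_Rintegral => s _; rewrite volterra_integrandE.
have V0 t : 0 <= V t.
  apply: Rintegral_ge0 => s /=; rewrite in_itv/= andbT => /W0/ltW s0.
  by rewrite mulr_ge0 ?powR_ge0.
have iV t : 0 < t -> (@lebesgue_measure R).-integrable `]0, +oo[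
    (fun s => (t `^ (s + alpha) * W s)%:E).
  move=> t0; apply: eq_integrable (cV t t0) => // s _.
  by rewrite volterra_integrandE.
have iG x : 0 < x -> (@lebesgue_measure R).-integrable `]0, +oo[
    (fun s => (x^-1 `^ (s + (alpha + lambda)) * Gamma (s + (alpha + lambda)) * W s)%:E).
  rewrite -invr_gt0 => x0; apply: eq_integrable (cV2 _ x0) => // s _.
  by rewrite volterra_integrand_rcons.
pose g t := t `^ (lambda - 1) * V t.
have W0' s : 0 < s -> 0 <= W s by move=> s0; apply/ltW/W0.
have LM x x0 := laplace_mellin W alpha lambda x halphalambda x0 mW W0' iV (iG x x0).
have VG x : volterra up1 lo (alpha + lambda) beta x =
    \int[@lebesgue_measure R]_(s in `]0, +oo[)
      (x `^ (s + (alpha + lambda)) * Gamma (s + (alpha + lambda)) * W s).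
  by apply: eq_Rintegral => s _; rewrite volterra_integrand_rcons.
have Vg x : 0 < x -> volterra up1 lo (alpha + lambda) beta x^-1 =
    \int[@lebesgue_measure R]_(t in `]0, +oo[) (expR (- (x * t)) * g t).
  move=> x0; have [_ e] := LM x x0; rewrite VG e.
  by apply: eq_Rintegral => t _; rewrite mulrA.
have ig x : 0 < x -> (@lebesgue_measure R).-integrable `]0, +oo[
    (fun t => (expR (- (x * t)) * g t)%:E).
  move=> x0; have [i _] := LM x x0.
  by apply: eq_integrable i => // t _; rewrite mulrA.
split.
(* The factor (1/x)^lambda = x^(-lambda) is constant in s and is taken out of the integral, which
   converges by [cV1]. *)
- move=> x x0; have xV0 : 0 < x^-1 by rewrite invr_gt0.
  rewrite /volterra -RintegralZl//; last exact: cV1.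
  apply: eq_Rintegral => s _; rewrite !volterra_integrand_rcons addrA.
  rewrite (@powRD _ _ (s + alpha) lambda); last by rewrite (gt_eqF xV0) implybT.
  rewrite -(powR_inv1 (ltW x0)) -!powRrM !mulN1r. ring.
- move=> x x0; have [i e] := LM x x0; split.
    by apply: eq_integrable i => // t _; rewrite VE.
  by rewrite VG e; apply: eq_Rintegral => t _; rewrite VE.
- have dn := derive1n_laplace
    (fun x => volterra up1 lo (alpha + lambda) beta x^-1) g ig Vg.
  split.
  (* Strict positivity is read off the integral over s, whose integrand is positive for every s > 0,
     instead of the Laplace form. *)
  + move=> x x0; rewrite VG; apply: integral_gt0; first exact: iG.
    move=> s s0; apply: mulr_gt0; last exact: W0.
    rewrite mulr_gt0 ?powR_gt0 ?invr_gt0 ?Gamma_gt0//.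
    by rewrite ltr_pwDl.
  + by move=> n x x0; have [] := dn n x x0.
  + move=> n x x0; have [_ ->] := dn n x x0.
    (* Under the integral, (-1)^n turns (-t)^n into t^n, leaving a product of nonnegative
       factors. *)
    rewrite -RintegralZl//; last exact: integrable_laplace_exprn.
    apply: Rintegral_ge0 => t /=; rewrite in_itv/= andbT => t0.
    rewrite mulrA -exprMn mulN1r opprK.
    by rewrite !mulr_ge0 ?exprn_ge0 ?expR_ge0 ?powR_ge0// ltW.
Qed.
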